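(* Let $a,b$ be positive integers, let $H$ be the underlying undirected bi-colored graph of an $[a,b]$-pebble game configuration, and let $e$ be an edge (red or black) not in $H$ which the $[a,b]$-pebble game fails to insert. Let $F$ be the set of edges returned by the pebble-finding subroutine for $e$ (if $e$ is black, the union of the sets returned by its two calls, with desired color tan and with desired color aqua). Then the fundamental circuit of $e$ in $H$, with respect to $[a,b]$-sparsity, is $F+e$ (that is, $F\cup\{e\}$ is not $[a,b]$-sparse, while $(F\cup\{e\})\setminus\{y\}$ is $[a,b]$-sparse for every $y\in F$).
   Context: A bi-colored graph is a finite multigraph $G=(V,E=B\sqcup R)$ whose edges are partitioned into black edges $B$ and red edges $R$. A multigraph is $(k,\ell)$-sparse if every nonempty subset of $n'$ vertices spans at most $kn'-\ell$ edges, and $(k,\ell)$-tight if in addition it has exactly $kn-\ell$ edges, $n$ being its number of vertices. A $(k,\ell)$-block is a set of vertices inducing a $(k,\ell)$-tight graph; a $(k,\ell)$-component is a vertex-maximal $(k,\ell)$-block. $G$ is $[a,b]$-sparse if there is $B'\subseteq B$ such that $(V,R\cup B')$ is $(a,a)$-sparse and $(V,B\setminus B')$ is $(b,b)$-sparse. The $[a,b]$-sparse edge sets are the independent sets of a matroid. If $H$ is $[a,b]$-sparse and $H+e$ is not, the fundamental circuit of $e$ in $H$ is the unique circuit of this matroid contained in $H+e$. Notation: $S+e=S\cup\{e\}$. The $[a,b]$-pebble game on $V$. A configuration consists of a directed bi-colored graph on $V$, with every edge covered by exactly one pebble, colored aqua or tan, together with free aqua and tan pebbles on the vertices, and obtained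 by allowed moves from the initial configuration: no edges; every vertex has $a$ free aqua and $b$ free tan pebbles. Allowed moves (preconditions in brackets; counts ''on $i$ and $j$'' are totals over the two vertices): - Add red edge $ij$ [at least $a+1$ free aqua pebbles on $i$ and $j$]: add the edge, cover it with a free aqua pebble from $i$, orient it out of $i$. - Add black edge $ij$ [at least $a+1$ free aqua, or at least $b+1$ free tan, pebbles on $i$ and $j$]: add the edge, cover it with a free pebble from $i$, using aqua (if there are $a+1$ aqua) or tan (if there are $b+1$ tan), orient it out of $i$. - Edge reversal [$j$ has a free pebble and an in-edge $ij$ covered by a pebble of the same color]: reorient the edge out of $j$, cover it with the pebble from $j$, return the old pebble to $i$. - Aqua exchange edge reversal [$j$ has a free aqua pebble and a black in-edge $ij$ covered by a tan pebble; $i,j$ are not in the same $(a,a)$-component of the aqua-covered edges]: reorient the edge out of $j$, cover it with the aqua pebble from $j$, return the tan pebble to $i$. - Tan exchange edge reversal [$j$ has a free tan pebble and a black in-edge $ij$ covered by an aqua pebble; $i,j$ are not in the same $(b,b)$-component of the tan-covered edges]: reorient the edge out of $j$, cover it with the tan pebble from $j$, return the aqua pebble to $i$. Basic pebble search. To collect pebbles of color $c$ on the endpoints $u,v$ of an edge $f$, repeatedly search from $u$ or $v$ along directed edges covered by $c$-colored pebbles for a vertex outside $\{u,v\}$ holding a free $c$-colored pebble, and bring that pebble to the start of the search by edge reversal moves along the path; stop when the desired number is reached (success) or when no such vertex is reachable (failure). The set $F'$ of edges visited by a failed search is the set of $c$-covered edges traversed in the final unsuccessful searches, i.e., the $c$-covered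 edges whose tail is reachable from $u$ or $v$ by a directed path of $c$-covered edges. Pebble-finding subroutine. Input: a configuration, an edge $e$, a desired color $c_e\in\{\text{aqua},\text{tan}\}$. Initialize $F=\emptyset$, a queue $Q$ containing only $(e,c_e)$, and $e.\mathrm{predecessor}=\mathrm{NIL}$. While $Q$ is nonempty: 1. Dequeue $(f,c)$. If $f\neq e$ and $f$ is red, go to the next iteration. 2. Use the basic pebble search to try to collect $a+1$ (if $c$ is aqua) or $b+1$ (if $c$ is tan) pebbles of color $c$ on the endpoints of $f$; let $F'$ be the set of edges visited by that search. 3. If the pebbles were collected: let $g=f$. While $g.\mathrm{predecessor}\neq\mathrm{NIL}$: let $d$ be the color of the pebble covering $g$, $\bar d$ the opposite color, $u,v$ the source and target of $g$; collect a free pebble of color $\bar d$ on $v$ by edge reversal moves; perform the $\bar d$ exchange edge reversal move on $g$; set $g=g.\mathrm{predecessor}$. Then collect $a+1$ (if the color is aqua) or $b+1$ (if tan) pebbles on the endpoints of $g=e$, and output true and $F\cup F'$. 4. Otherwise: for each $g\in F'\setminus F$ set $g.\mathrm{predecessor}=f$ and enqueue $(g,\bar c)$, with $\bar c$ the color opposite to $c$; then set $F=F\cup F'$. If $Q$ becomes empty, output false and $F$. Insertion of an edge $e$ by the pebble game: if $e$ is black, call the subroutine with color tan; if it returns true, insert $e$ by an add black edge move. Otherwise, or if $e$ is red, call the subroutine with color aqua; if it returns true, insert $e$ by an add edge move. Otherwise the game fails to insert $e$ (rejects it). *)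

(* Defs.v *)
From HB Require Import structures.
From mathcomp Require Import all_boot.

Set Implicit Arguments.
Unset Strict Implicit.
Unset Printing Implicit Defensive.

(* [E] is an ambient finite supply of edges: a bi-colored graph on [V] is a set
   of edges [H : {set E}].  Parallel edges and loops are allowed. *)
Record bigraph (V E : finType) := Bigraph {
  end1 : E -> V;
  end2 : E -> V;
  red : pred E }.

Section Sparsity.
Context (V E : finType) (G : bigraph V E).
Implicit Types (H F C : {set E}) (W X : {set V}).

Definition ends (f : E) : {set V} := [set end1 G f; end2 G f].

Definition spanned F X : {set E} := [set f in F | ends f \subset X].

(* The subtraction in "k n' - l" is the integer one; it is moved to the other
   side because subtraction on [nat] is truncated. *)
Definition sparse_on (k l : nat) W F : bool :=
  [forall X : {set V}, (X != set0) && (X \subset W) ==>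
     (#|spanned F X| + l <= k * #|X|)].

Definition sparse (k l : nat) F : bool := sparse_on k l [set: V] F.

Definition tight_on (k l : nat) W F : bool :=
  sparse_on k l W F && (#|F| + l == k * #|W|).

Definition block (k l : nat) F W : bool := tight_on k l W (spanned F W).

Definition component (k l : nat) F W : bool := maxset (block k l F) W.

Definition same_component (k l : nat) F (i j : V) : bool :=
  [exists W : {set V}, [&& component k l F W, i \in W & j \in W]].

Definition red_part H : {set E} := [set f in H | red G f].
Definition black_part H : {set E} := [set f in H | ~~ red G f].

Definition ab_sparse (a b : nat) H : bool :=
  [exists B' : {set E}, [&& B' \subset black_part H,
     sparse a a (red_part H :|: B') & sparse b b (black_part H :\: B')]].

Definition circuit (a b : nat) C : bool :=
  minset (fun D : {set E} => ~~ ab_sparse a b D) C.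

Definition fundamental_circuit (a b : nat) H (e : E) C : Prop :=
  [/\ ab_sparse a b H, ~~ ab_sparse a b (e |: H),
      circuit a b C, C \subset e |: H &
      forall D : {set E}, circuit a b D -> D \subset e |: H -> D = C].

End Sparsity.

Variant color := Aqua | Tan.

Definition bool_of_color c := if c is Aqua then true else false.
Definition color_of_bool b := if b then Aqua else Tan.
Lemma bool_of_colorK : cancel bool_of_color color_of_bool.
Proof. by case. Qed.
HB.instance Definition _ := Equality.copy color (can_type bool_of_colorK).

Definition opp (c : color) : color := if c is Aqua then Tan else Aqua.

(* [dir s f] tells whether [f] is directed from [end1] to [end2]; [dir s] and
   [cover s] are meaningful only on [edges s]. *)
Record config (V E : finType) := Config {
  edges : {set E};
  dir : E -> bool;
  cover : E -> color;
  free : color -> V -> nat }.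

Section Game.
Context (V E : finType) (G : bigraph V E) (a b : nat).
Implicit Types (s : config V E) (f g e : E) (c : color) (F : {set E}).
Implicit Types (S : {set V}) (x w : V).

Definition cap c : nat := if c is Aqua then a else b.

Definition source s f : V := if dir s f then end1 G f else end2 G f.
Definition target s f : V := if dir s f then end2 G f else end1 G f.

Definition covered s c : {set E} := [set f in edges s | cover s f == c].

(* As [S] is a set, the pebbles on the endpoints of a loop are counted once. *)
Definition pebbles s c S : nat := \sum_(x in S) free s c x.

Definition give c x (p : color -> V -> nat) : color -> V -> nat :=
  fun c' y => if (c' == c) && (y == x) then (p c' y).+1 else p c' y.
Definition take_from c x (p : color -> V -> nat) : color -> V -> nat :=
  fun c' y => if (c' == c) && (y == x) then (p c' y).-1 else p c' y.

Definition initial : config V E :=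
  Config set0 (fun _ => true) (fun _ => Aqua) (fun c _ => cap c).

Definition add_edge f (d : bool) c s : config V E :=
  Config (f |: edges s) [eta dir s with f |-> d] [eta cover s with f |-> c]
    (take_from c (if d then end1 G f else end2 G f) (free s)).

Definition can_add f (d : bool) c s : bool :=
  [&& f \notin edges s, red G f ==> (c == Aqua),
      0 < free s c (if d then end1 G f else end2 G f) &
      (cap c).+1 <= pebbles s c (ends G f)].

Definition reverse f s : config V E :=
  Config (edges s) [eta dir s with f |-> ~~ dir s f] (cover s)
    (give (cover s f) (source s f)
       (take_from (cover s f) (target s f) (free s))).

Definition can_reverse f s : bool :=
  (f \in edges s) && (0 < free s (cover s f) (target s f)).

Definition exchange f s : config V E :=
  Config (edges s) [eta dir s with f |-> ~~ dir s f]
    [eta cover s with f |-> opp (cover s f)]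
    (give (cover s f) (source s f)
       (take_from (opp (cover s f)) (target s f) (free s))).

Definition can_exchange f s : bool :=
  let c := opp (cover s f) in
  [&& f \in edges s, ~~ red G f, 0 < free s c (target s f) &
      ~~ same_component G (cap c) (cap c) (covered s c)
           (source s f) (target s f)].

Inductive move : config V E -> config V E -> Prop :=
| move_add s f d c : can_add f d c s -> move s (add_edge f d c s)
| move_reverse s f : can_reverse f s -> move s (reverse f s)
| move_exchange s f : can_exchange f s -> move s (exchange f s).

Inductive configuration : config V E -> Prop :=
| conf_initial : configuration initial
| conf_move s s' : configuration s -> move s s' -> configuration s'.

Fixpoint dipath s c x (p : seq E) w : bool :=
  if p is f :: q then
    [&& f \in covered s c, source s f == x & dipath s c (target s f) q w]
  else x == w.

Definition simple_dipath s c x (p : seq E) w : bool :=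
  dipath s c x p w && uniq (x :: [seq target s f | f <- p]).

Definition reachable s c S : pred V :=
  fun w => [exists x in S,
    connect (fun y z => [exists f in covered s c,
                           (source s f == y) && (target s f == z)]) x w].

Definition visited s c S : {set E} :=
  [set f in covered s c | reachable s c S (source s f)].

(* The last edge of the path is reversed first. *)
Definition reverse_path (p : seq E) s : config V E := foldr reverse s p.

Definition fetch c S s s' : Prop :=
  exists x w (p : seq E),
    [/\ x \in S, w \notin S, 0 < free s c w, simple_dipath s c x p w &
        s' = reverse_path p s].

(* [collect c S n s ok s']: trying to gather [n] pebbles of color [c] on [S]
   leads from [s] to [s'], with success iff [ok]. *)
Inductive collect c S (n : nat) : config V E -> bool -> config V E -> Prop :=
| collect_success s : n <= pebbles s c S -> collect c S n s true s
| collect_failure s : pebbles s c S < n ->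
    (forall w, reachable s c S w -> w \notin S -> free s c w = 0) ->
    collect c S n s false s
| collect_fetch s s1 ok s2 : pebbles s c S < n -> fetch c S s s1 ->
    collect c S n s1 ok s2 -> collect c S n s ok s2.

Definition search f c s ok s' : Prop :=
  collect c (ends G f) (cap c).+1 s ok s'.

Inductive backtrack (prev : E -> option E) :
    E -> config V E -> config V E -> Prop :=
| backtrack_stop g s : prev g = None -> backtrack prev g s s
| backtrack_step g h s s1 s2 : prev g = Some h ->
    collect (opp (cover s g)) [set target s g] 1 s true s1 ->
    can_exchange g s1 ->
    backtrack prev h (exchange g s1) s2 ->
    backtrack prev g s s2.

(* [find_loop e ce s F prev Q ok F1 s1]: from configuration [s], with visited
   set [F], predecessors [prev] and queue [Q], the while loop may output [ok]
   and [F1], ending in configuration [s1].  The edges visited by a successful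
   search depend on the traversal order and are left unconstrained among the
   edges covered by the searched color; [gs] is an arbitrary enqueuing order. *)
Inductive find_loop e (ce : color) :
    config V E -> {set E} -> (E -> option E) -> seq (E * color) ->
    bool -> {set E} -> config V E -> Prop :=
| find_empty s F prev : find_loop e ce s F prev [::] false F s
| find_red s F prev f c Q ok F1 s1 :
    f != e -> red G f ->
    find_loop e ce s F prev Q ok F1 s1 ->
    find_loop e ce s F prev ((f, c) :: Q) ok F1 s1
| find_success s F prev f c Q F' s1 s2 s3 :
    (f == e) || ~~ red G f ->
    search f c s true s1 ->
    F' \subset covered s1 c ->
    backtrack prev f s1 s2 ->
    search e ce s2 true s3 ->
    find_loop e ce s F prev ((f, c) :: Q) true (F :|: F') s3
| find_failure s F prev f c Q F' gs s1 ok F2 s2 :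
    (f == e) || ~~ red G f ->
    search f c s false s1 ->
    F' = visited s1 c (ends G f) ->
    uniq gs -> gs =i F' :\: F ->
    find_loop e ce s1 (F :|: F')
      (fun g => if g \in F' :\: F then Some f else prev g)
      (Q ++ [seq (g, opp c) | g <- gs]) ok F2 s2 ->
    find_loop e ce s F prev ((f, c) :: Q) ok F2 s2.

Definition find_pebbles e c s ok F s' : Prop :=
  find_loop e c s set0 (fun _ => None) [:: (e, c)] ok F s'.

(* The result is [None] if [e] is inserted, and [Some F] if [e] is rejected and
   [F] is the set of edges returned by the subroutine. *)
Inductive insertion e s : option {set E} -> config V E -> Prop :=
| insert_black_tan F s1 d c :
    ~~ red G e -> find_pebbles e Tan s true F s1 -> can_add e d c s1 ->
    insertion e s None (add_edge e d c s1)
| insert_black_aqua F1 s1 F2 s2 d c :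
    ~~ red G e -> find_pebbles e Tan s false F1 s1 ->
    find_pebbles e Aqua s1 true F2 s2 -> can_add e d c s2 ->
    insertion e s None (add_edge e d c s2)
| reject_black F1 s1 F2 s2 :
    ~~ red G e -> find_pebbles e Tan s false F1 s1 ->
    find_pebbles e Aqua s1 false F2 s2 ->
    insertion e s (Some (F1 :|: F2)) s2
| insert_red F s1 d c :
    red G e -> find_pebbles e Aqua s true F s1 -> can_add e d c s1 ->
    insertion e s None (add_edge e d c s1)
| reject_red F s1 :
    red G e -> find_pebbles e Aqua s false F s1 ->
    insertion e s (Some F) s1.

End Game.

(* Main.v *)
(* Colour the edges of [H] by the pebbles covering them; each colour class is
   sparse.  When the search for an edge [f] fails, the visited edges are those
   spanned by the smallest block of the searched class that contains [f],
   whatever the orientation; so a failing subroutine returns the smallest set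
   [F] closed under "the fundamental circuit of [f] in the opposite class", for
   [f] in [e |: F].  Both classes of [F] then span [e |: F] in their matroids,
   which makes [e |: F] dependent by counting.  Conversely, if [y] is in [H] and
   [e |: (H :\ y)] is dependent, no augmenting path leaves [e] in [H :\ y], and
   the set reached from [e] in its exchange graph is closed and avoids [y]; hence
   every dependent subset of [e |: H] contains [e |: F]. *)
From mathcomp Require Import all_boot zify.
Require Import Defs.

Set Implicit Arguments.
Unset Strict Implicit.
Unset Printing Implicit Defensive.

(** * Sparse edge sets and their blocks *)

Section SparseMatroid.
Context (V E : finType) (G : bigraph V E) (k : nat).
Implicit Types (I J F : {set E}) (X Y M : {set V}) (f g : E).

Lemma in_spanned F X f : (f \in spanned G F X) = (f \in F) && (ends G f \subset X).
Proof. by rewrite inE. Qed.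

Lemma spannedS F1 F2 X : F1 \subset F2 -> spanned G F1 X \subset spanned G F2 X.
Proof.
move=> sF; apply/subsetP=> f; rewrite !in_spanned => /andP[fF ->].
by rewrite (subsetP sF).
Qed.

Lemma sparseP F :
  reflect (forall X, X != set0 -> #|spanned G F X| + k <= k * #|X|)
          (sparse G k k F).
Proof.
apply: (iffP forallP) => sF X; last by apply/implyP; rewrite subsetT andbT; apply: sF.
by move=> X0; have := sF X; rewrite X0 subsetT.
Qed.

Lemma sparseS F1 F2 : F1 \subset F2 -> sparse G k k F2 -> sparse G k k F1.
Proof.
move=> sF /sparseP spF; apply/sparseP=> X /spF.
by apply: leq_trans; rewrite leq_add2r subset_leq_card ?spannedS.
Qed.

Lemma ends_neq0 f : ends G f != set0.
Proof. by apply/set0Pn; exists (end1 G f); rewrite !inE eqxx. Qed.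

Lemma ends_sub_neq0 f X : ends G f \subset X -> X != set0.
Proof. by apply: contraTneq => ->; rewrite subset0 ends_neq0. Qed.

(** The sparsity half of tightness is inherited from [F], so only the count on [X] itself has to be
    checked. *)
Lemma blockE F X :
  sparse G k k F -> block G k k F X = (#|spanned G F X| + k == k * #|X|).
Proof.
move=> /sparseP sF; rewrite /block /tight_on.
case: eqP => _; rewrite ?andbF ?andbT //.
apply/forallP=> Y; apply/implyP=> /andP[Y0 YX].
apply: leq_trans (sF Y Y0); rewrite leq_add2r; apply/subset_leq_card/spannedS.
by apply/subsetP=> f; rewrite in_spanned => /andP[].
Qed.

Lemma eq_block F1 F2 X :
  spanned G F1 X = spanned G F2 X -> block G k k F1 X = block G k k F2 X.
Proof. by rewrite /block => ->. Qed.

(** A block of [F1] already holds as many edges as the sparsity of [F2] permits, so [F2] has no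
    further edge there. *)
Lemma blockS F1 F2 X :
  F1 \subset F2 -> sparse G k k F2 -> X != set0 -> block G k k F1 X ->
  block G k k F2 X /\ spanned G F1 X = spanned G F2 X.
Proof.
move=> sF sF2 X0 bX.
suff eqF : spanned G F1 X = spanned G F2 X by rewrite -(eq_block eqF).
apply/eqP; rewrite eqEcard spannedS //= -(leq_add2r k).
move: bX; rewrite blockE ?(sparseS sF) // => /eqP->.
by move/sparseP: sF2; apply.
Qed.

Lemma spannedI F X Y :
  spanned G F (X :&: Y) = spanned G F X :&: spanned G F Y.
Proof.
by apply/setP=> f; rewrite !inE subsetI; case: (f \in F) => //=; case: (_ \subset Y).
Qed.

Lemma spanned_supermodular F X Y :
  #|spanned G F X| + #|spanned G F Y| <=
  #|spanned G F (X :&: Y)| + #|spanned G F (X :|: Y)|.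
Proof.
rewrite spannedI -cardsUI addnC leq_add2l; apply/subset_leq_card/subsetP=> f.
by rewrite !inE => /orP[] /andP[-> /subset_trans ->] //; rewrite (subsetUl, subsetUr).
Qed.

(** Uncrossing: [k * #|X| - k] is modular and the number of spanned edges supermodular, so equality
    for two sets that meet forces equality for their intersection and union. *)
Lemma block_UI F X Y :
  sparse G k k F -> X :&: Y != set0 -> block G k k F X -> block G k k F Y ->
  block G k k F (X :&: Y) && block G k k F (X :|: Y).
Proof.
move=> sF XY0; rewrite !blockE // => /eqP bX /eqP bY.
have XUY0 : X :|: Y != set0.
  by apply: contraNneq XY0; rewrite -!subset0 => <-; rewrite subIset ?subsetUl.
have /sparseP spF := sF; have := spF _ XY0; have := spF _ XUY0.
have := spanned_supermodular F X Y; have := cardsUI X Y.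
move: #|_ (X :&: Y)| #|_ (X :|: Y)| #|_ X| #|_ Y| bX bY => i u x y.
move: #|X| #|Y| #|X :&: Y| #|X :|: Y| => cx cy ci cu bX bY ec.
have := f_equal (muln k) ec; rewrite !mulnDr; lia.
Qed.

(** Only the vertex sets spanning [f] can gain an edge, and none of them attains the bound. *)
Lemma sparse_add F f :
  sparse G k k F -> (forall X, block G k k F X -> ~~ (ends G f \subset X)) ->
  sparse G k k (f |: F).
Proof.
move=> sF nb; apply/sparseP=> X X0; have /sparseP/(_ X X0) lX := sF.
have [fX|fX] := boolP (ends G f \subset X); last first.
  suff -> : spanned G (f |: F) X = spanned G F X by [].
  apply/setP=> g; rewrite !inE; case: eqP => //= ->.
  by rewrite (negbTE fX) andbF.
have : #|spanned G (f |: F) X| <= #|spanned G F X|.+1.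
  rewrite -add1n -(cards1 f); apply: leq_trans (leq_card_setU _ _).
  by apply/subset_leq_card/subsetP=> g; rewrite !inE; case: eqP.
have : #|spanned G F X| + k != k * #|X|.
  by rewrite -blockE //; apply: contraL fX; apply: nb.
lia.
Qed.

(** Blocks around [f] share its ends, hence are stable under intersection. For [f] outside [I], the
    edges spanned by [M] together with [f] form the fundamental circuit of [f] in [I]. *)
Lemma block_min I f X :
  sparse G k k I -> block G k k I X -> ends G f \subset X ->
  exists M, [/\ block G k k I M, ends G f \subset M &
    forall Y, block G k k I Y -> ends G f \subset Y -> M \subset Y].
Proof.
move=> sI bX fX; pose P Y := block G k k I Y && (ends G f \subset Y).
have [|M /minsetP[/andP[bM fM] minM] _] := @minset_exists _ P X; first exact/andP.
exists M; split=> // Y bY fY; have fMY : ends G f \subset M :&: Y by rewrite subsetI fM.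
have /andP[bMY _] := block_UI sI (ends_sub_neq0 fMY) bM bY.
by apply/setIidPl/minM; rewrite ?subsetIl // /P bMY.
Qed.

Lemma block1 I x : sparse G k k I -> block G k k I [set x].
Proof.
move=> sI; rewrite blockE // cards1 muln1.
have /sparseP/(_ [set x]) := sI; rewrite cards1 muln1.
have /set0Pn-> : exists y, y \in [set x] by exists x; rewrite set11.
by move/(_ isT); lia.
Qed.

(** * Maximal blocks and comparison of cardinalities *)

Definition blocks I : {set {set V}} := [set X | component G k k I X].

Hypothesis k_gt0 : 0 < k.

Lemma block_neq0 F X : block G k k F X -> X != set0.
Proof.
move=> /andP[_ /eqP bX]; apply/eqP=> X0.
by move: bX; rewrite X0 cards0 muln0; lia.
Qed.

Lemma trivIset_blocks I : sparse G k k I -> trivIset (blocks I).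
Proof.
move=> sI; apply/trivIsetP=> X Y; rewrite !inE => /maxsetP[bX mX] /maxsetP[bY mY].
rewrite -setI_eq0; apply: contra_neqT => XY0.
have /andP[_ bU] := block_UI sI XY0 bX bY.
by rewrite -(mX _ bU (subsetUl _ _)) (mY _ bU (subsetUr _ _)).
Qed.

Lemma block_sub_pblock I X x :
  sparse G k k I -> block G k k I X -> x \in X ->
  pblock (blocks I) x \in blocks I /\ X \subset pblock (blocks I) x.
Proof.
move=> sI bX xX; have [M mM sXM] := maxset_exists bX.
have MI : M \in blocks I by rewrite inE.
have -> : pblock (blocks I) x = M.
  by apply: def_pblock; rewrite ?trivIset_blocks ?(subsetP sXM).
by [].
Qed.

(* The maximal blocks of [I] partition the vertices, since singletons are
   blocks; [J] and [I] agree outside the blocks, and inside a block [X] the set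
   [I] attains the bound [k * #|X| - k]. *)
Lemma leq_card_sparse I J :
  sparse G k k I -> sparse G k k J ->
  (forall f, f \in J -> f \notin I ->
     exists2 X, block G k k I X & ends G f \subset X) ->
  #|J| <= #|I|.
Proof.
(* Maximal blocks are disjoint, so [p f] is the only one that can span [f]; [inner] gathers the
   edges lying inside a maximal block. *)
move=> sI sJ dJ; pose p f := pblock (blocks I) (end1 G f).
pose inner := [set f | ends G f \subset p f].
have pI f : p f \in blocks I.
  by have [] := @block_sub_pblock I [set end1 G f] (end1 G f) sI (block1 _ sI) (set11 _).
have innerE (F : {set E}) :
    #|F :&: inner| = \sum_(M in blocks I) #|spanned G F M|.
  rewrite -sum1_card (partition_big p (fun M => M \in blocks I)) //=.
  apply: eq_bigr => M MI; rewrite -sum1_card; apply: eq_bigl => f.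
  rewrite in_setI in_spanned inE -andbA; congr andb.
  apply/andP/idP => [[fp /eqP<-] // | fM].
  suff -> : p f = M by [].
  apply: def_pblock (trivIset_blocks sI) MI _.
  by apply: (subsetP fM); rewrite !inE eqxx.
rewrite -(cardsID inner J) -(cardsID inner I) !innerE; apply: leq_add.
  apply: leq_sum => M; rewrite inE => /maxsetP[bM _].
  have /sparseP/(_ M (block_neq0 bM)) := sJ.
  by move: bM; rewrite blockE // => /eqP<-; rewrite leq_add2r.
apply/subset_leq_card/subsetP=> f; rewrite !inE => /andP[ninner fJ].
rewrite ninner; apply: contraR ninner => /(dJ f fJ)[X bX fX].
have fX1 : end1 G f \in X by apply: (subsetP fX); rewrite !inE eqxx.
by apply: subset_trans fX _; have [] := block_sub_pblock sI bX fX1.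
Qed.

End SparseMatroid.

(** * Colourings with two sparse classes *)

Section Augmentation.
Context (V E : finType) (G : bigraph V E) (a b : nat).
Hypotheses (a_gt0 : 0 < a) (b_gt0 : 0 < b).
Implicit Types (H T D F : {set E}) (X Y M : {set V}) (e f g y : E) (x w : V).
Implicit Types (col : E -> color) (c d : color).

Lemma cap_gt0 c : 0 < cap a b c. Proof. by case: c. Qed.
Hint Resolve cap_gt0 : core.

Lemma neq_color c d : (c != d) = (c == opp d).
Proof. by case: c; case: d. Qed.

Definition cls H col c : {set E} := [set f in H | col f == c].

(** The colouring form of a witness for [ab_sparse]: the aqua black edges play the role of [B']. *)
Definition valid H col : bool :=
  (sparse G a a (cls H col Aqua) && sparse G b b (cls H col Tan)) &&
  [forall f in H, red G f ==> (col f == Aqua)].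

Definition allowed c f : bool := red G f ==> (c == Aqua).

Local Notation blk c I := (block G (cap a b c) (cap a b c) I).

Lemma in_cls H col c f : (f \in cls H col c) = (f \in H) && (col f == c).
Proof. by rewrite inE. Qed.

Lemma validP H col :
  reflect ((forall c, sparse G (cap a b c) (cap a b c) (cls H col c)) /\
           forall f, f \in H -> allowed (col f) f) (valid H col).
Proof.
apply: (iffP andP) => [[/andP[sA sT] /forallP rH]|[sH rH]].
  by split=> [[]|f fH] //; have := rH f; rewrite fH.
by rewrite (sH Aqua) (sH Tan); split=> //; apply/forall_inP.
Qed.

Lemma valid_ab_sparse H col : valid H col -> ab_sparse G a b H.
Proof.
case/validP=> sH rH; apply/existsP; exists (black_part G H :&: cls H col Aqua).
rewrite subsetIl /=; have := sH Aqua; have := sH Tan; rewrite /= => sT sA.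
apply/andP; split.
  apply: sparseS sA; apply/subsetP=> f; rewrite !inE.
  case: (boolP (f \in H)) => //= /rH; rewrite /allowed.
  by case: (red G f) => //=; rewrite ?orbF.
apply: sparseS sT; apply/subsetP=> f; rewrite !inE.
by case: (f \in H); case: (red G f); case: (col f).
Qed.

Lemma ab_sparseS D H : D \subset H -> ab_sparse G a b H -> ab_sparse G a b D.
Proof.
move=> DH /existsP[B' /and3P[sB sA sT]]; apply/existsP; exists (B' :&: D).
have sub f : f \in D -> f \in H by apply: (subsetP DH).
apply/and3P; split.
- apply/subsetP=> f; rewrite inE => /andP[/(subsetP sB)].
  by rewrite !inE => /andP[_ ->] ->.
- apply: sparseS sA; apply/subsetP=> f; rewrite !inE.
  by case/orP=> /andP[]; [move=> /sub-> -> | move=> ->; rewrite orbT].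
- apply: sparseS sT; apply/subsetP=> f; rewrite !inE.
  by case/andP=> nB /andP[fD ->]; rewrite (sub _ fD); move: nB; rewrite fD andbT => ->.
Qed.

Lemma valid_setD1 H col y : valid H col -> valid (H :\ y) col.
Proof.
case/validP=> sH rH; apply/validP; split=> [c|f /setD1P[_]]; last exact: rH.
by apply: sparseS (sH c); apply/subsetP=> f; rewrite !inE => /andP[/andP[_ ->]].
Qed.

(** * Recolouring one edge; augmenting paths *)

Lemma cls_recolor H col y c d :
  cls (y |: H) [eta col with y |-> c] d =
  if d == c then y |: cls H col c else cls H col d :\ y.
Proof.
apply/setP=> f; rewrite !inE /=; case: eqP => [-> | /eqP fy] //=.
  by case: (eqVneq d c) => _; rewrite !inE eqxx ?andbF.
by case: (eqVneq d c) => [->|_]; rewrite !inE (negbTE fy).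
Qed.

(** The form [y |: H] covers both the insertion of a new edge and the recolouring of an edge of
    [H]. *)
Lemma valid_recolor H col y c :
  valid H col -> allowed c y ->
  (forall X, blk c (cls H col c) X -> ~~ (ends G y \subset X)) ->
  valid (y |: H) [eta col with y |-> c].
Proof.
move=> /validP[sH rH] ycc ny; apply/validP; split=> [d|f].
  rewrite cls_recolor; case: eqP => [->|_]; first exact: sparse_add.
  by apply: sparseS (sH d); apply: subD1set.
by rewrite in_setU1 => /predU1P[-> | /rH fH] /=; [rewrite eqxx | case: eqP => [->|]].
Qed.

(* [f] has an arc to [g] when [g] lies on the fundamental circuit of [f] in
   some class [c] not containing [f]. *)
Definition addable H col c f : bool :=
  [&& allowed c f, f \notin cls H col c &
      [forall X, blk c (cls H col c) X ==> ~~ (ends G f \subset X)]].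

Definition arc_via H col c f g : bool :=
  [&& allowed c f, f \notin cls H col c, g \in cls H col c &
      [forall X, blk c (cls H col c) X ==> (ends G f \subset X) ==>
                 (ends G g \subset X)]].

Definition insertable H col f : bool :=
  addable H col Aqua f || addable H col Tan f.
Definition arc H col f g : bool :=
  arc_via H col Aqua f g || arc_via H col Tan f g.

Lemma insertableP H col f :
  reflect (exists c, addable H col c f) (insertable H col f).
Proof.
by apply: (iffP orP) => [[]|[[]]]; [exists Aqua | exists Tan | left | right].
Qed.

Lemma arcP H col f g : reflect (exists c, arc_via H col c f g) (arc H col f g).
Proof.
by apply: (iffP orP) => [[]|[[]]]; [exists Aqua | exists Tan | left | right].
Qed.

Lemma addable_block H col c f :
  allowed c f -> f \notin cls H col c -> ~~ addable H col c f ->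
  exists2 X, blk c (cls H col c) X & ends G f \subset X.
Proof.
move=> fc nf; rewrite /addable fc nf => /forallPn[X].
by rewrite negb_imply negbK => /andP[bX fX]; exists X.
Qed.

(* Moving the last edge [y] of a path [x, ..., z, y] to a class where it fits
   makes [z] insertable, and keeps the fundamental circuits of those edges of
   the path that have no arc to [y]. *)
Section Exchange.
Variables (H : {set E}) (col : E -> color) (z y : E) (c : color).
Hypotheses (vH : valid H col) (yH : y \in H) (yc : addable H col c y).
Let col' : E -> color := [eta col with y |-> c].

Let ny X : blk c (cls H col c) X -> ~~ (ends G y \subset X).
Proof. by case/and3P: yc => _ _ /forallP/(_ X)/implyP. Qed.

Let col_y : col y != c.
Proof. by case/and3P: yc; rewrite in_cls yH. Qed.

Let cls_c : cls H col' c = y |: cls H col c.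
Proof. by rewrite -{1}(setUidPr (_ : [set y] \subset H)) ?sub1set // cls_recolor eqxx. Qed.

Let cls_nc d : d != c -> cls H col' d = cls H col d :\ y.
Proof.
move=> dc; rewrite -{1}(setUidPr (_ : [set y] \subset H)) ?sub1set //.
by rewrite cls_recolor (negbTE dc).
Qed.

Lemma exchange_valid : valid H col'.
Proof.
have /and3P[yac _ _] := yc.
by have := valid_recolor vH yac ny; rewrite (setUidPr _) ?sub1set.
Qed.

(** A class other than [c] can only lose [y], and a set that is still tight after the loss cannot
    have spanned [y]. *)
Lemma block_exchange d X :
  d != c -> blk d (cls H col' d) X -> blk d (cls H col d) X /\
  (y \in cls H col d -> ~~ (ends G y \subset X)).
Proof.
move=> dc; rewrite cls_nc // => bX; have X0 := block_neq0 (cap_gt0 d) bX.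
have /validP[/(_ d) sd _] := vH.
have [bX' eX] := blockS (subD1set _ _) sd X0 bX; split=> // yd.
by apply/negP=> yX; move/setP/(_ y): eX; rewrite !in_spanned !inE eqxx yX in yd *; rewrite yd.
Qed.

(** Every block around [z] in the class of [y] spans [y] too, hence is destroyed when [y] leaves. *)
Lemma exchange_insertable : arc H col z y -> z != y -> insertable H col' z.
Proof.
case/arcP=> d /and4P[zd nz yd /forallP az] zy; apply/insertableP; exists d.
have dc : d != c by apply: contraNneq col_y => <-; move: yd; rewrite in_cls => /andP[].
apply/and3P; split=> //; first by rewrite cls_nc // in_setD1 (negbTE nz) andbF.
apply/forallP=> X; apply/implyP=> /(block_exchange dc)[bX /(_ yd)].
by apply: contra => zX; have := az X; rewrite bX zX.
Qed.

Lemma exchange_arc u v :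
  u != y -> v != y -> ~~ insertable H col u -> ~~ arc H col u y ->
  arc H col u v -> arc H col' u v.
Proof.
move=> uy vy nu nuy /arcP[d /and4P[ud nud vd /forallP uv]].
apply/arcP; exists d; rewrite /arc_via ud /=.
have [dc|dc] := eqVneq d c; last first.
  rewrite cls_nc // !in_setD1 (negbTE nud) andbF vy vd -cls_nc //=.
  apply/forallP=> X; apply/implyP=> /(block_exchange dc)[bX _].
  by have := uv X; rewrite bX.
rewrite {d}dc in ud nud vd uv *; rewrite cls_c !in_setU1 (negbTE uy) nud vd orbT /=.
have nau : ~~ addable H col c u by apply: contra nu => ?; apply/insertableP; exists c.
(* The class [c] gains [y], so a block [X] around [u] may be new. An old block [Y] around [u] keeps
   its edges, hence does not span [y], and [X :&: Y] is then an old block to which the arc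
   applies. *)
have [Y bY uY] := addable_block ud nud nau.
have /validP[/(_ c) sc _] := vH; have /validP[/(_ c) sc' _] := exchange_valid.
rewrite cls_c in sc'.
have [bY' eqY] := blockS (subsetU1 y _) sc' (ends_sub_neq0 uY) bY.
apply/forallP=> X; apply/implyP=> bX; apply/implyP=> uX.
have uXY : ends G u \subset X :&: Y by rewrite subsetI uX.
have /andP[bXY _] := block_UI sc' (ends_sub_neq0 uXY) bX bY'.
have bXY' : blk c (cls H col c) (X :&: Y).
  suff eqXY : spanned G (cls H col c) (X :&: Y) = spanned G (y |: cls H col c) (X :&: Y).
    by rewrite (eq_block _ eqXY).
  apply/setP=> f; have /setP/(_ f) := eqY; rewrite !in_spanned subsetI.
  by case: (ends G f \subset Y); rewrite ?andbF ?andbT // => ->.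
by have := uv (X :&: Y); rewrite bXY' uXY /= subsetI => /andP[].
Qed.

End Exchange.

(** The path is cut at an earlier insertable edge, or shortened by an arc from an earlier edge to
    its last edge [y]. When neither exists, recolouring [y] keeps the remaining arcs and makes the
    predecessor of [y] insertable, so the path loses [y]. *)
Lemma augment n : forall H col (x : E) p, size p <= n -> valid H col -> x \notin H ->
  path (arc H col) x p -> insertable H col (last x p) -> ab_sparse G a b (x |: H).
Proof.
elim: n => [|n IHn] H col x p szp vH xH.
  case: p szp => //= _ _ /insertableP[c /and3P[xc _ /forallP nx]].
  by apply: valid_ab_sparse (valid_recolor vH xc _) => X /(implyP (nx X)).
case/lastP: p szp => [_|q y]; first exact: (IHn H col x [::]).
rewrite size_rcons ltnS rcons_path last_rcons => szq /andP[pq zy] iy.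
have [/hasP[u uq iu]|/hasPn niq] := boolP (has (insertable H col) (x :: q)).
  case/splitPl: uq szq pq => q1 q2 qE; rewrite size_cat cat_path => szq /andP[pq1 _].
  by apply: (IHn H col x q1) => //; rewrite ?qE //; lia.
have yH : y \in H.
  by case/arcP: zy => c /and4P[_ _]; rewrite in_cls => /andP[].
have nyq : {in x :: q, forall u, u != y}.
  by move=> u /niq; apply: contraNneq => ->.
have lq : last x q \in x :: q by apply: mem_last.
(* [belast x q] leaves out the edge just before [y], whose arc to [y] gives no shortcut. *)
have [/hasP[u uq uy]|/hasPn nuy] := boolP (has (arc H col ^~ y) (belast x q)).
  move: uq szq pq zy {niq nyq lq}.
  case/lastP: q => // q z; rewrite belast_rcons => uq.
  case/splitPl: uq => q1 q2 qE; rewrite size_rcons size_cat => szq pq _.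
  apply: (IHn H col x (rcons q1 y)); rewrite ?size_rcons ?last_rcons ?rcons_path ?qE ?uy //.
    by lia.
  by move: pq; rewrite rcons_path cat_path => /andP[/andP[->]].
have /insertableP[c yc] := iy.
apply: (IHn H [eta col with y |-> c] x q) => //; first exact: exchange_valid.
  have: {subset belast x q <= x :: q} by apply: mem_belast.
  have: {subset q <= x :: q} by move=> u uq; rewrite inE uq orbT.
  (* [s] freezes the whole path, so that the conditions on its members survive the induction on
     [q]. *)
  move: (x :: q) niq nyq nuy pq {szq zy lq xH} => s niq nyq.
  elim: q x => //= v q IHq x nuy /andP[xv pq] sq sb; apply/andP; split.
    have xs : x \in s by apply/sb/mem_head.
    apply: exchange_arc; rewrite ?nyq ?niq ?nuy ?mem_head //.
    by apply/sq/mem_head.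
  apply: IHq => // u uq; [apply: nuy|apply: sq|apply: sb]; by rewrite inE uq orbT.
by apply: exchange_insertable; rewrite ?nyq.
Qed.

(** * Closed sets and the fundamental circuit *)

(** Any block [M] serves, because the smallest block around [f] lies inside it: for [f] outside
    class [c], the condition says that [T] contains the rest of the fundamental circuit of [f] in
    that class. *)
Definition good H col c f T : Prop :=
  exists M, [/\ blk c (cls H col c) M, ends G f \subset M &
                spanned G (cls H col c) M \subset T].

Definition closed_from H col e T : Prop :=
  forall f c, f \in e |: T -> allowed c f -> f \notin cls H col c ->
  good H col c f T.

Lemma closed_of_dependent H col e y :
  valid H col -> e \notin H -> ~~ ab_sparse G a b (e |: (H :\ y)) ->
  exists2 T : {set E}, T \subset H :\ y & closed_from H col e T.
Proof.
move=> vH eH dep; have vH' := valid_setD1 y vH.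
have eH' : e \notin H :\ y by rewrite in_setD1 (negbTE eH) andbF.
exists [set g in H :\ y | connect (arc (H :\ y) col) e g].
  by apply/subsetP=> g; rewrite inE => /andP[].
move=> f c fT fc nf.
have ef : connect (arc (H :\ y) col) e f.
  by move: fT; rewrite in_setU1 inE => /predU1P[-> //|/andP[]].
have ni : ~~ insertable (H :\ y) col f.
  apply: contra dep; have /connectP[p pe ->] := ef.
  exact: augment vH' eH' pe.
have nf' : f \notin cls (H :\ y) col c.
  by apply: contra nf; rewrite !in_cls => /andP[/setD1P[_ ->]].
have nadd : ~~ addable (H :\ y) col c f.
  by apply: contra ni => ?; apply/insertableP; exists c.
have [X bX fX] := addable_block fc nf' nadd.
have /validP[/(_ c) sc _] := vH; have /validP[/(_ c) sc' _] := vH'.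
have [M [bM fM minM]] := block_min sc' bX fX.
have sub : cls (H :\ y) col c \subset cls H col c.
  by apply/subsetP=> g; rewrite !in_cls => /andP[/setD1P[_ ->]].
(* Blocks for [H :\ y] are blocks for [H] with the same edges, so closure holds in [H] although the
   reached set was computed without [y]. *)
have [bM' eM] := blockS sub sc (ends_sub_neq0 fM) bM.
exists M; split=> //; rewrite -eM; apply/subsetP=> g.
rewrite in_spanned => /andP[gH gM]; rewrite inE; apply/andP; split.
  by move: gH; rewrite in_cls => /andP[].
apply: connect_trans ef (connect1 _); apply/arcP; exists c.
rewrite /arc_via fc nf' gH; apply/forallP=> Y; apply/implyP=> bY; apply/implyP=> fY.
by apply: subset_trans gM _; apply: minM.
Qed.

Lemma closed_dependent H col e F :
  valid H col -> e \notin H -> F \subset H -> closed_from H col e F ->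
  ~~ ab_sparse G a b (e |: F).
Proof.
move=> vH eH FH clF; apply/negP=> /existsP[B' /and3P[/subsetP sB sA sT]].
have sub c : cls F col c \subset cls H col c.
  by apply/subsetP=> f; rewrite !in_cls => /andP[/(subsetP FH)-> ->].
have /validP[sH _] := vH.
(* Either part of a decomposition of [e |: F] is spanned by the class of [F] of its colour, hence is
   no larger; the two bounds add up to only [#|F|] edges. *)
have bound c (J : {set E}) : sparse G (cap a b c) (cap a b c) J ->
    (forall f, f \in J -> f \in e |: F /\ allowed c f) -> #|J| <= #|cls F col c|.
  move=> sJ aJ; apply: (leq_card_sparse (cap_gt0 c)) sJ _.
    exact: sparseS (sub c) (sH c).
  move=> f /aJ[fF fc] nf.
  have nfH : f \notin cls H col c.
    move: fF nf; rewrite in_setU1 !in_cls => /predU1P[-> _|-> /= /negbTE->].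
      by rewrite (negbTE eH).
    by rewrite andbF.
  have [M [bM fM sM]] := clF f c fF fc nfH.
  (* [M] is a block for the class of [H]; as the edges of that class spanned by it lie in [F], it is
     also one for the class of [F]. *)
  exists M => //; rewrite (@eq_block _ _ _ _ _ (cls H col c)) //.
  apply/eqP; rewrite eqEsubset spannedS //=; apply/subsetP=> g gM.
  have gF := subsetP sM g gM; move: gM.
  by rewrite !in_spanned !in_cls gF => /andP[/andP[_ ->] ->].
have := bound Aqua _ sA; have := bound Tan _ sT => bT bA.
have {bT} bT : #|black_part G (e |: F) :\: B'| <= #|cls F col Tan|.
  apply: bT => f; rewrite /allowed /black_part in_setD inE => /and3P[_ -> nr].
  by rewrite (negbTE nr).
have {bA} bA : #|red_part G (e |: F) :|: B'| <= #|cls F col Aqua|.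
  apply: bA => f fJ; split; last by rewrite /allowed implybT.
  by case/setUP: fJ => [|/sB]; rewrite inE => /andP[].
have eF : e \notin F by apply: contra eH; apply: (subsetP FH).
have eFc : cls F col Aqua :|: cls F col Tan = F.
  by apply/setP=> f; rewrite in_setU !in_cls -andb_orr; case: (col f); rewrite andbT.
have cF : #|F| = #|cls F col Aqua| + #|cls F col Tan|.
  rewrite -{1}eFc cardsU; suff -> : cls F col Aqua :&: cls F col Tan = set0.
    by rewrite cards0 subn0.
  by apply/setP=> f; rewrite in_setI !in_cls in_set0; case: (col f); rewrite !andbF.
have cU : #|e |: F| <= #|red_part G (e |: F) :|: B'| + #|black_part G (e |: F) :\: B'|.
  apply: leq_trans (leq_card_setU _ _); apply/subset_leq_card/subsetP=> f fF.
  rewrite in_setU in_setU in_setD [f \in black_part _ _]inE [f \in red_part _ _]inE fF.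
  by case: (red G f); case: (f \in B').
have := cardsU1 e F; rewrite eF; lia.
Qed.

Lemma fundamental_circuit_closure H col e F :
  valid H col -> e \notin H -> F \subset H -> closed_from H col e F ->
  (forall T, T \subset H -> closed_from H col e T -> F \subset T) ->
  fundamental_circuit G a b H e (e |: F).
Proof.
move=> vH eH FH clF minF; have sH := valid_ab_sparse vH.
have depF := closed_dependent vH eH FH clF.
have FeH : e |: F \subset e |: H by rewrite setUS.
(* Both minimality and uniqueness of the circuit come from this. An edge [y] missing from [D] is not
   [e], as [H] is sparse, and some closed set inside [H :\ y] contains [F]. *)
have subD D : ~~ ab_sparse G a b D -> D \subset e |: H -> e |: F \subset D.
  move=> depD sD; apply/subsetP=> y.
  have DH z : z \notin D -> D \subset (e |: H) :\ z.
    by move=> zD; rewrite subsetD1 sD.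
  apply: contraTT => yD; rewrite in_setU1 negb_or.
  have ye : y != e.
    apply: contraNneq depD => ye; apply: ab_sparseS sH.
    by have := DH y yD; rewrite ye setU1K.
  rewrite ye /=.
  have dep : ~~ ab_sparse G a b (e |: (H :\ y)).
    apply: contra depD; apply: ab_sparseS; apply: subset_trans (DH y yD) _.
    by apply/subsetP=> f; rewrite !inE => /andP[->].
  have [T TH clT] := closed_of_dependent vH eH dep.
  have TH' : T \subset H by apply: subset_trans TH (subsetDl _ _).
  apply: contra (subsetP (minF T TH' clT) y) _; apply/negP=> /(subsetP TH).
  by rewrite !inE eqxx.
split=> //; first by apply: contra depF; apply: ab_sparseS.
  apply/minsetP; split=> // D depD DF.
  by apply/eqP; rewrite eqEsubset DF subD // (subset_trans DF).
move=> D /minsetP[depD minD] DH.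
by apply/esym/minD => //; apply: subD.
Qed.

Lemma goodS H col c f T1 T2 : T1 \subset T2 -> good H col c f T1 -> good H col c f T2.
Proof. by move=> sT [M [bM fM sM]]; exists M; split=> //; apply: subset_trans sT. Qed.

(** * Invariant of the pebble game *)

Implicit Types (s : config V E).

Definition out s c x : {set E} := [set f in covered s c | source G s f == x].

(** A pebble covering an edge belongs to the source of that edge, so each vertex keeps its [cap]
    pebbles of either colour throughout the game. *)
Definition game_inv s : Prop :=
  valid (edges s) (cover s) /\ forall c x, free s c x + #|out s c x| = cap a b c.

Lemma ends_dir s f : ends G f = [set source G s f; target G s f].
Proof. by rewrite /source /target /ends; case: (dir s f); rewrite // setUC. Qed.

Lemma source_ends s f : source G s f \in ends G f.
Proof. by rewrite (ends_dir s) set21. Qed.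

Lemma target_ends s f : target G s f \in ends G f.
Proof. by rewrite (ends_dir s) set22. Qed.

Lemma pebbles_out s c X :
  game_inv s ->
  pebbles s c X + #|[set f in covered s c | source G s f \in X]| = cap a b c * #|X|.
Proof.
move=> [_ fo]; rewrite mulnC -sum_nat_const -(eq_bigr _ (fun x _ => fo c x)) big_split /=.
congr addn; rewrite -sum1_card (partition_big (source G s) (fun x => x \in X)) /=; last first.
  by move=> f; rewrite inE => /andP[].
apply: eq_bigr => x xX; rewrite -sum1_card; apply: eq_bigl => f.
by rewrite !inE -andbA; case: (source G s f =P x) => [->|_]; rewrite ?andbF ?xX.
Qed.

Lemma spanned_source s c X :
  spanned G (covered s c) X \subset [set f in covered s c | source G s f \in X].
Proof.
apply/subsetP=> f; rewrite in_spanned inE => /andP[-> /subsetP fX].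
exact/fX/source_ends.
Qed.

Lemma pebblesS s c X Y : X \subset Y -> pebbles s c X <= pebbles s c Y.
Proof. by move/setIidPr=> XY; rewrite /pebbles [leqRHS](big_setID X) /= XY leq_addr. Qed.

Lemma inv_sparse s c :
  game_inv s -> sparse G (cap a b c) (cap a b c) (covered s c).
Proof. by case=> /validP[/(_ c)]. Qed.

(** Why [(cap c).+1] pebbles are asked for: the edges spanned by a block take all but [cap c] of the
    pebbles of its vertices, so one more on the ends of an edge shows that no block contains
    them. *)
Lemma block_pebbles s c X :
  game_inv s -> blk c (covered s c) X -> pebbles s c X <= cap a b c.
Proof.
move=> inv_s; rewrite blockE; last exact: inv_sparse.
have := pebbles_out c X inv_s; have := subset_leq_card (spanned_source s c X).
by move=> ? ? /eqP; lia.
Qed.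

(** Each move alters a single edge [f], so the count at a vertex only has to be balanced there;
    membership of [f] counts as 0 or 1. *)
Lemma inv_transfer s s' f :
  game_inv s -> valid (edges s') (cover s') ->
  (forall c x g, g != f -> (g \in out s' c x) = (g \in out s c x)) ->
  (forall c x, free s' c x + (f \in out s' c x) = free s c x + (f \in out s c x)) ->
  game_inv s'.
Proof.
move=> [_ fo] v' og of'; split=> // c x; have := fo c x.
rewrite (cardsD1 f (out s c x)) (cardsD1 f (out s' c x)) !addnA of'.
suff -> : out s' c x :\ f = out s c x :\ f by [].
by apply/setP=> g; rewrite !in_setD1; case: eqP => //= /eqP /og.
Qed.

Lemma inv_reverse s f : game_inv s -> can_reverse G f s -> game_inv (reverse G f s).
Proof.
move=> inv_s /andP[fs pf]; apply: (inv_transfer (f := f) inv_s); first by case: inv_s.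
  by move=> c x g gf; rewrite !inE /= /source /= (negbTE gf).
move=> c x; rewrite !inE fs /= /source /= eqxx /give /take_from.
move: pf; rewrite /target /source.
case: (eqVneq (cover s f) c) => [<-|_] //=.
case: (dir s f) => /=.
  case: (eqVneq x (end1 G f)) => [->|_]; case: (eqVneq _ (end2 G f)) => [->|_] /=; lia.
case: (eqVneq x (end2 G f)) => [->|_]; case: (eqVneq _ (end1 G f)) => [->|_] /=; lia.
Qed.

Lemma inv_exchange s f :
  game_inv s -> can_exchange G a b f s -> game_inv (exchange G f s).
Proof.
move=> inv_s /and4P[fs nr pf nc]; apply: (inv_transfer (f := f) inv_s).
- have -> : edges (exchange G f s) = f |: edges s by rewrite (setUidPr _) ?sub1set.
  apply: valid_recolor; [by case: inv_s | by rewrite /allowed (negbTE nr) |].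
  (* A block around [f] would extend to a component containing both of its ends. *)
  move=> X bX; apply: contra nc => fX; have [M cM XM] := maxset_exists bX.
  apply/existsP; exists M; rewrite /component cM /=.
  by rewrite !(subsetP XM) // (subsetP fX) // (source_ends, target_ends).
- by move=> c x g gf; rewrite !inE /= /source /= (negbTE gf).
move=> c x; rewrite !inE fs /= /source /= eqxx /give /take_from.
move: pf; rewrite /target /source.
case: (cover s f) => /=; case: c => /=; case: (dir s f) => /=; rewrite ?andbF //=;
  case: (eqVneq x) => [->|] //=; lia.
Qed.

Lemma inv_add s f (d : bool) c :
  game_inv s -> can_add G a b f d c s -> game_inv (add_edge G f d c s).
Proof.
move=> inv_s /and4P[fs fc pf pe]; apply: (inv_transfer (f := f) inv_s).
- apply: valid_recolor => //; first by case: inv_s.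
  move=> X bX; apply/negP=> /(pebblesS s c); have := block_pebbles inv_s bX; lia.
- by move=> c' x g gf; rewrite !inE /= /source /= (negbTE gf).
move=> c' x; rewrite !inE (negbTE fs) /= /source /= eqxx /take_from.
move: pf; case: (eqVneq c' c) => [->|cc]; rewrite ?eqxx //=.
by case: (eqVneq x) => [->|] //=; lia.
Qed.

Lemma configuration_inv s : configuration G a b s -> game_inv s.
Proof.
elim=> {s} [|s1 s2 _ + mv]; last first.
  by case: mv => *; [apply: inv_add | apply: inv_reverse | apply: inv_exchange].
have c0 col c : cls set0 col c = set0 by apply/setP=> f; rewrite !inE.
split=> [|c x].
  apply/validP; split=> [c|f]; last by rewrite in_set0.
  rewrite c0; apply/sparseP=> X; rewrite -card_gt0 => X0.
  have -> : spanned G set0 X = set0 by apply/setP=> f; rewrite !inE.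
  by rewrite cards0 leq_pmulr.
by rewrite /= (_ : out _ _ _ = set0) ?cards0 ?addn0 //; apply/setP=> f; rewrite !inE.
Qed.

(** * Pebble collection and failed searches *)

(** Reversals change only directions and free pebbles, so the colour classes and their blocks stay
    the same throughout a failing run. *)
Definition same_graph s s' : Prop := edges s' = edges s /\ cover s' = cover s.

Lemma same_graph_trans s1 s2 s3 : same_graph s1 s2 -> same_graph s2 s3 -> same_graph s1 s3.
Proof. by case=> e12 c12 [e23 c23]; split; [rewrite e23 | rewrite c23]. Qed.

Lemma same_graph_covered s s' c : same_graph s s' -> covered s' c = covered s c.
Proof. by case=> e' c'; rewrite /covered e' c'. Qed.

(** Reversing from the far end carries the free pebble from [w] back to [x]. The targets along a
    simple path are distinct, so an edge does not recur later and still has its original direction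
    when its turn comes; the last clause carries this through the induction. *)
Lemma reverse_path_inv s c x p w :
  game_inv s -> simple_dipath G s c x p w -> 0 < free s c w ->
  let s1 := reverse_path G p s in
  [/\ game_inv s1, same_graph s s1, 0 < free s1 c x & {in [predC p], dir s1 =1 dir s}].
Proof.
move=> inv_s /andP[]; elim: p x => [|f p IHp] x /=.
  by move=> /eqP-> _ fw; split=> //; split.
case/and3P=> fc /eqP sf pp /andP[/norP[xf xp] up] fw.
have [inv1 [e1 c1] f1 d1] := IHp _ pp up fw.
have fp : f \notin p.
  by apply: contraTN up => fp; rewrite /= (map_f (fun g => target G s g)).
have t1 : target G (reverse_path G p s) f = target G s f by rewrite /target d1.
have s1 : source G (reverse_path G p s) f = x by rewrite /source d1 // -sf.
move: fc; rewrite inE => /andP[fs /eqP cf].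
have cr : can_reverse G f (reverse_path G p s).
  by rewrite /can_reverse e1 fs c1 cf t1 f1.
split=> //; first exact: inv_reverse.
  by rewrite /= /give c1 cf s1 !eqxx.
move=> g; rewrite !inE => /norP[gf gp] /=.
by rewrite (negbTE gf) d1.
Qed.

Lemma collect_inv s c X n ok s1 :
  collect G c X n s ok s1 -> game_inv s ->
  [/\ game_inv s1, same_graph s s1 &
      ~~ ok -> pebbles s1 c X < n /\
        forall w, reachable G s1 c X w -> w \notin X -> free s1 c w = 0].
Proof.
elim=> {s ok s1} [s _ inv_s|s pn nr inv_s|s s1 ok s2 _ [x [w [p [_ _ fw pp ->]]]] _ IH inv_s].
- by split=> //; split.
- by split=> //; split.
have [inv1 g1 _ _] := reverse_path_inv inv_s pp fw.
by have [inv2 g2 nr] := IH inv1; split=> //; apply: same_graph_trans g1 g2.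
Qed.

(* No pebble lies on the reached vertices outside [ends G f] and no edge leaves
   them, so they form a block, whose [cap] spare pebbles all are on [ends G f];
   hence no edge leaves any other block containing [ends G f] either. *)
Lemma search_failed s f c s1 :
  search G a b f c s false s1 -> game_inv s ->
  [/\ game_inv s1, same_graph s s1 &
      exists M, [/\ blk c (covered s c) M, ends G f \subset M,
        visited G s1 c (ends G f) = spanned G (covered s c) M &
        forall Y, blk c (covered s c) Y -> ends G f \subset Y -> M \subset Y]].
Proof.
move=> sr inv_s; have [inv1 g1 /(_ isT)[pf nr]] := collect_inv sr inv_s.
split=> //; rewrite -(same_graph_covered c g1).
set X := [set w | reachable G s1 c (ends G f) w].
have fX : ends G f \subset X.
  by apply/subsetP=> x xf; rewrite inE; apply/existsP; exists x; rewrite xf connect0.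
have outX g : g \in covered s1 c -> source G s1 g \in X -> target G s1 g \in X.
  move=> gc; rewrite !inE => /existsP[x /andP[xf xg]].
  apply/existsP; exists x; rewrite xf (connect_trans xg) // connect1 //.
  by apply/existsP; exists g; rewrite gc !eqxx.
have vE : visited G s1 c (ends G f) = spanned G (covered s1 c) X.
  apply/eqP; rewrite eqEsubset; apply/andP; split; apply/subsetP=> g.
    rewrite inE in_spanned => /andP[gc gX].
    have sX : source G s1 g \in X by rewrite inE.
    by rewrite gc (ends_dir s1) subUset !sub1set sX outX.
  by move/(subsetP (spanned_source _ _ _)); rewrite !inE => /andP[->].
have srcX : [set g in covered s1 c | source G s1 g \in X] = spanned G (covered s1 c) X.
  by rewrite -vE; apply/setP=> g; rewrite !inE.
have pX : pebbles s1 c X = pebbles s1 c (ends G f).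
  rewrite /pebbles (big_setID (ends G f)) /= (setIidPr fX) [X in _ + X]big1 ?addn0 //.
  by move=> w /setDP[]; rewrite inE; apply: nr.
have sp := inv_sparse c inv1.
have := pebbles_out c X inv1; rewrite srcX pX => eX.
have /sparseP/(_ X (ends_sub_neq0 fX)) lX := sp.
have bX : blk c (covered s1 c) X by rewrite blockE //; apply/eqP; lia.
exists X; split=> // Y bY fY.
have srcY : spanned G (covered s1 c) Y = [set g in covered s1 c | source G s1 g \in Y].
  apply/eqP; rewrite eqEcard spanned_source /=.
  have := pebbles_out c Y inv1; have := pebblesS s1 c fY.
  by move: bY; rewrite blockE // => /eqP; lia.
have outY g : g \in covered s1 c -> source G s1 g \in Y -> target G s1 g \in Y.
  move=> gc gY; have : g \in spanned G (covered s1 c) Y by rewrite srcY inE gc.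
  by rewrite in_spanned => /andP[_ /subsetP]; apply; apply: target_ends.
apply/subsetP=> w; rewrite inE => /existsP[x /andP[/(subsetP fY) xY]].
case/connectP=> p pp ->; elim: p x xY pp => //= y p IHp x xY /andP[/existsP[g]].
by case/and3P=> gc /eqP sg /eqP tg; apply: IHp; rewrite -tg outY // sg.
Qed.

(** * The output of a failing subroutine *)

(** The induction on the run needs an arbitrary state of the loop: edges already in [F] are left out
    of the second clause, since their queue entries may be gone, and minimality is claimed among the
    sets [T] that meet the demands still in the queue. *)
Lemma find_loop_failed e ce s F prev Q ok F1 s1 :
  find_loop G a b e ce s F prev Q ok F1 s1 -> ~~ ok -> game_inv s ->
  e \notin edges s -> F \subset edges s ->
  [/\ game_inv s1, same_graph s s1, F \subset F1 & F1 \subset edges s] /\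
  [/\ forall f c, (f, c) \in Q -> (f == e) || ~~ red G f ->
        good (edges s) (cover s) c f F1,
      forall g, g \in F1 -> g \notin F -> ~~ red G g ->
        good (edges s) (cover s) (opp (cover s g)) g F1 &
      forall T, F \subset T ->
        (forall f c, (f, c) \in Q -> (f == e) || ~~ red G f ->
           good (edges s) (cover s) c f T) ->
        (forall g, g \in T -> ~~ red G g ->
           good (edges s) (cover s) (opp (cover s g)) g T) ->
        F1 \subset T].
Proof.
elim=> {s F prev Q ok F1 s1} //.
- move=> s F prev _ inv_s es Fs; split; split=> //.
  by move=> g gF /negP[].
- move=> s F prev f c Q ok F1 s1 fe rf _ IH nok inv_s es Fs.
  have [? [gQ gF minF]] := IH nok inv_s es Fs.
  split=> //; split=> // [g d|T FT gT clT].
    by rewrite in_cons => /predU1P[[-> _]|/gQ //]; rewrite (negbTE fe) rf.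
  by apply: minF => // g d gQ'; apply: gT; rewrite in_cons gQ' orbT.
move=> s F prev f c Q F' gs s1 ok F2 s2 fe sr F'E _ gsE _ IH nok inv_s es Fs.
have [inv1 [e1 c1] [M [bM fM vM minM]]] := search_failed sr inv_s.
rewrite {}vM in F'E; have F's : F' \subset covered s c.
  by rewrite F'E; apply/subsetP=> g; rewrite in_spanned => /andP[].
have F'col g : g \in F' -> g \in edges s /\ cover s g = c.
  by move/(subsetP F's); rewrite inE => /andP[gs' /eqP].
rewrite e1 c1 in IH; have [||[inv2 g2 FF2 F2s] [gQ gF minF]] := IH nok inv1 => //.
  by rewrite subUset Fs; apply/subsetP=> g /F'col[].
have F'F2 : F' \subset F2 by apply: subset_trans FF2; apply: subsetUr.
split; first split=> //.
- by apply: same_graph_trans g2; split.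
- by apply: subset_trans FF2; apply: subsetUl.
split.
- move=> g d; rewrite in_cons => /predU1P[[-> ->] _|gQ'].
    by exists M; rewrite -F'E.
  by apply: gQ; rewrite mem_cat gQ'.
- move=> g gF2 gnF nr; have [gF'|gnF'] := boolP (g \in F'); last first.
    by apply: gF => //; rewrite in_setU negb_or gnF.
  have [_ ->] := F'col g gF'.
  apply: gQ; last by rewrite nr orbT.
  by rewrite mem_cat map_f ?orbT // gsE in_setD gnF.
move=> T FT gT clT.
(* [T] contains the class edges of some block around [f], hence those of the smallest one, [M]. *)
have F'T : F' \subset T.
  have [||M' [bM' fM' sM']] := gT f c => //; first by rewrite mem_head.
  apply: subset_trans sM'; rewrite F'E; apply/subsetP=> g.
  rewrite !in_spanned => /andP[-> /subset_trans]; apply; exact: minM.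
apply: minF => //; first by rewrite subUset FT.
move=> g d; rewrite mem_cat => /orP[gQ'|].
  by apply: gT; rewrite in_cons gQ' orbT.
case/mapP=> h; rewrite gsE => /setDP[hF' _] [-> ->].
have [hs <-] := F'col h hF'.
(* [h] is an edge of the graph and [e] is not, so the side condition says that [h] is black. *)
case: eqP es hs => [-> /negP // | _ _ _ /= nr].
by apply: clT => //; apply: (subsetP F'T).
Qed.

Lemma find_pebbles_failed e c s F s1 :
  find_pebbles G a b e c s false F s1 -> game_inv s -> e \notin edges s ->
  [/\ game_inv s1, same_graph s s1 & F \subset edges s] /\
  [/\ good (edges s) (cover s) c e F,
      forall g, g \in F -> ~~ red G g ->
        good (edges s) (cover s) (opp (cover s g)) g F &
      forall T, T \subset edges s -> closed_from (edges s) (cover s) e T ->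
        allowed c e -> F \subset T].
Proof.
move=> fp inv_s es.
have [[inv1 g1 _ Fs] [gQ gF minF]] := find_loop_failed fp isT inv_s es (sub0set _).
split=> //; split.
- by apply: gQ; rewrite ?mem_head ?eqxx.
- by move=> g gF'; apply: gF; rewrite ?in_set0.
move=> T Ts clT ec; apply: minF; first exact: sub0set.
  move=> f d; rewrite mem_seq1 => /eqP[-> ->] _.
  by apply: clT; rewrite ?setU11 // in_cls (negbTE es).
move=> g gT nr; apply: clT; first by rewrite in_setU1 gT orbT.
  by rewrite /allowed (negbTE nr).
by rewrite in_cls (subsetP Ts) //=; case: (cover s g).
Qed.

(** For an edge of [F] the only class to consider is the one opposite to its pebble; for a red edge
    this is tan, which is not allowed. Hence the loop may skip red edges. *)
Lemma closed_fromI s e F :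
  game_inv s -> e \notin edges s -> F \subset edges s ->
  (forall c, allowed c e -> good (edges s) (cover s) c e F) ->
  (forall g, g \in F -> ~~ red G g ->
     good (edges s) (cover s) (opp (cover s g)) g F) ->
  closed_from (edges s) (cover s) e F.
Proof.
move=> [/validP[_ rs] _] es Fs ge gF f c; rewrite in_setU1 => /predU1P[-> ec _|fF fc].
  exact: ge.
have fs := subsetP Fs f fF; rewrite in_cls fs eq_sym neq_color => /eqP cE.
rewrite {}cE in fc *; apply: gF => //; apply: contraL fc.
by have := rs f fs; rewrite /allowed => + rf; rewrite rf /= => /eqP->.
Qed.

End Augmentation.

Theorem lemma5p3 (V E : finType) (G : bigraph V E) (a b : nat)
    (a_gt0 : 0 < a) (b_gt0 : 0 < b) (s s' : config V E) (e : E) (F : {set E})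
    (s_conf : configuration G a b s) (eH : e \notin edges s)
    (e_rejected : insertion G a b e s (Some F) s') :
  fundamental_circuit G a b (edges s) e (e |: F).
Proof.
have inv_s := configuration_inv a_gt0 b_gt0 s_conf.
have [vs _] := inv_s.
inversion e_rejected as [| |F1 s1 F2 s2 nr fp1 fp2| |F1 s1 r fp].
  have [[inv1 [e1 c1] F1s] [ge1 gF1 min1]] := find_pebbles_failed a_gt0 b_gt0 fp1 inv_s eH.
  have eH1 : e \notin edges s1 by rewrite e1.
  have [[_ _ F2s] [ge2 gF2 min2]] := find_pebbles_failed a_gt0 b_gt0 fp2 inv1 eH1.
  (* The failed first call only reversed edges, so both calls speak of the same colour classes. *)
  rewrite e1 c1 in F2s ge2 gF2 min2.
  have sub1 := subsetUl F1 F2; have sub2 := subsetUr F1 F2.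
  have al c : allowed G c e by rewrite /allowed (negbTE nr).
  apply: (fundamental_circuit_closure a_gt0 b_gt0 vs eH); first by rewrite subUset F1s.
    apply: (closed_fromI inv_s eH); first by rewrite subUset F1s.
      by case=> _; [apply: goodS ge2 | apply: goodS ge1].
    by move=> g /setUP[gF|gF] gr; [apply: goodS (gF1 g gF gr) | apply: goodS (gF2 g gF gr)].
  (* Each call returns a set contained in every closed [T], so the union is the smallest closed
     set. *)
  by move=> T Ts clT; rewrite subUset min1 // min2.
have [[_ _ Fs] [ge gF minF]] := find_pebbles_failed a_gt0 b_gt0 fp inv_s eH.
apply: (fundamental_circuit_closure a_gt0 b_gt0 vs eH Fs).
  by apply: (closed_fromI inv_s eH Fs) => // c; rewrite /allowed r => /eqP->.
by move=> T Ts clT; apply: minF; rewrite // /allowed implybT.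
Qed.
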